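(* The Picard numbers of abelian varieties are asymptotically complete, that is, the following limit exists and \[ \lim_{g \to +\infty} \frac{\# R_g}{g^2} = 1. \]
   Context: Abelian varieties are over the field $\mathbb{C}$ of complex numbers. The Picard number $\rho(A)$ of an abelian variety $A$ is the rank of its Néron–Severi group $\operatorname{NS}(A)$; if $\dim A = g\ge 1$ then $1 \leq \rho(A) \leq g^2$. For $g \geq 1$, $R_g$ denotes the set of all integers $\rho$ such that there exists an abelian variety $A$ of dimension $g$ with $\rho(A) = \rho$; $\#R_g$ is its cardinality. *)

(* Defs.v *)
From mathcomp Require Import all_boot all_order all_algebra.
From mathcomp Require Import all_classical all_reals all_analysis.
From mathcomp Require Import finmap complex.

Set Implicit Arguments.
Unset Strict Implicit.
Unset Printing Implicit Defensive.

Import Order.TTheory GRing.Theory Num.Theory.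
Import numFieldNormedType.Exports.

Local Open Scope classical_set_scope.
Local Open Scope ring_scope.

Definition zfree (V : zmodType) (n : nat) (v : 'I_n -> V) : Prop :=
  forall c : 'I_n -> int, \sum_(i < n) v i *~ c i = 0 -> forall i, c i = 0.

(** [has_rank S n]: the subgroup [S] has rank [n], i.e. [n] is the maximal
    cardinality of a Z-linearly independent family of elements of [S]. *)
Definition has_rank (V : zmodType) (S : set V) (n : nat) : Prop :=
  (exists2 v : 'I_n -> V, (forall i, S (v i)) & zfree v) /\
  (forall (m : nat) (v : 'I_m -> V), (forall i, S (v i)) -> zfree v ->
     (m <= n)%N).

(** [C^g] is ['rV[R[i]]_g]. A lattice in it is the set of integral
    combinations of [2g] vectors (the rows of [B]) which are linearly
    independent over the reals. *)
Definition is_lattice (R : realType) (g : nat) (L : set 'rV[R[i]]_g) : Prop :=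
  exists2 B : 'M[R[i]]_(g + g, g),
    forall x : 'rV[R]_(g + g), map_mx (real_complex R) x *m B = 0 -> x = 0 &
    L = [set map_mx intr m *m B | m in [set: 'rV[int]_(g + g)]].

(** The sesquilinear form [(u, v) |-> u H v^*] on [C^g] with matrix [H],
    linear in [u] and antilinear in [v]. *)
Definition hform (R : realType) (g : nat) (H : 'M[R[i]]_g)
    (u v : 'rV[R[i]]_g) : R[i] :=
  form (@Num.conj R[i]) H u v.

(** The Neron-Severi group of the complex torus [C^g / L]. By the
    Appell-Humbert theorem, the first Chern class identifies the group of
    line bundles modulo [Pic^0] with the group of Hermitian forms on [C^g]
    whose imaginary part is integral on [L] (equivalently with the integral
    alternating forms on [L] of type (1,1)); Hermitian forms are given here by
    their matrices. *)
Definition NS (R : realType) (g : nat) (L : set 'rV[R[i]]_g) :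
    set 'M[R[i]]_g :=
  [set H | H \is hermsymmx /\
           forall x y, L x -> L y -> complex.Im (hform H x y) \is a Num.int].

Definition posdef (R : realType) (g : nat) (H : 'M[R[i]]_g) : Prop :=
  forall v : 'rV[R[i]]_g, v != 0 -> 0 < hform H v v.

(** A complex abelian variety of dimension [g], as a complex torus [C^g / L]
    carrying a polarization, i.e. the class of a positive definite line
    bundle (a Riemann form). *)
Record abelian_variety (R : realType) (g : nat) := AbelianVariety {
  lattice :> set 'rV[R[i]]_g;
  latticeP : is_lattice lattice;
  polarizable : exists2 H, NS lattice H & posdef H }.

Definition has_picard_number (R : realType) (g : nat)
    (A : abelian_variety R g) (rho : nat) : Prop :=
  has_rank (NS A) rho.

Definition picard_numbers (R : realType) (g : nat) : set nat :=
  [set rho | exists A : abelian_variety R g, has_picard_number A rho].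

(** [fset_set] sends infinite sets to the empty set; this plays no role here,
    as Picard numbers in dimension [g] are at most [g ^ 2]. *)
Definition num_picard_numbers (R : realType) (g : nat) : nat :=
  #|` fset_set (picard_numbers R g)|%fset.

(* Main.v *)
From HB Require Import structures.
Require Import Defs.
From mathcomp Require Import all_boot all_order all_algebra.
From mathcomp Require Import all_classical all_reals all_analysis.
From mathcomp Require Import finmap complex zify lra.
Import Order.TTheory GRing.Theory Num.Theory.
Import numFieldNormedType.Exports.
Local Open Scope classical_set_scope.
Local Open Scope ring_scope.

Set Implicit Arguments.
Unset Strict Implicit.
Unset Printing Implicit Defensive.

(** Let A be a product of elliptic curves C/(Z + i y_k Z). A Hermitian matrix H
    lies in NS(A) iff, for all k and l, Re H_kl is in (1/y_k)Z and in (1/y_l)Z,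
    and Im H_kl and y_k y_l Im H_kl are in Z. So a pair k < l contributes 1 to
    rho(A) when y_k / y_l is rational, and 1 more when y_k y_l is. Take n of the
    y_k equal to 1 (complex multiplication) and the others among the
    2^(1/2^(c+1)), c > 0, with multiplicities m_c: then
    rho(A) = n^2 + sum_c m_c (m_c + 1) / 2.

    Given M, write M = n(n-1) + t(t-1)/2 + s with t(t-1)/2 + s < 2n and s < t.
    One class of size t, s classes of size 2 and singletons give rho(A) = g + M
    as soon as n + t + 2s <= g, hence for all M < (g - 6k)^2 if k^2 >= g. So all
    but O(g^(3/2)) of the integers up to g^2 are Picard numbers.

    Conversely, if H_1, ..., H_r in NS(A) are independent over Z, their integral
    Gram matrices on the lattice are independent over Z, hence over R, so that
    the H_i are independent over R and r <= g^2. *)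

(** * Integral relations from a rank deficiency *)

Lemma common_denominator (I : finType) (u : I -> rat) :
  exists2 d : int, d != 0 & forall i, exists z : int, d%:~R * u i = z%:~R.
Proof.
exists (\prod_i denq (u i)); first by apply/prodf_neq0 => i _; apply: denq_neq0.
move=> i; exists ((\prod_(j | j != i) denq (u j)) * numq (u i)).
by rewrite (bigD1 i) //= mulrC rmorphM mulrA -numqE -rmorphM mulrC.
Qed.

(* The rank over [F] is computed over the rationals, and denominators cleared. *)
Lemma int_dependency (F : numFieldType) m n (A : 'M[int]_(m, n)) :
    (\rank (map_mx intr A : 'M[F]_(m, n)) < m)%N ->
  exists2 c : 'I_m -> int, exists i, c i != 0 &
    forall j, \sum_i A i j * c i = 0.
Proof.
pose AQ : 'M[rat]_(m, n) := map_mx intr A.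
have -> : (map_mx intr A : 'M[F]_(m, n)) = map_mx ratr AQ.
  by rewrite -map_mx_comp; apply: eq_map_mx => z /=; rewrite ratr_int.
rewrite mxrank_map => ltAm.
have : kermx AQ != 0 by rewrite kermx_eq0 -row_leq_rank -ltnNge.
case/rowV0Pn => u /sub_kermxP uA u0.
have [d d0 dP] := common_denominator (u 0).
have [c cE] : exists c : 'I_m -> int, forall i, d%:~R * u 0 i = (c i)%:~R.
  exists (fun i => numq (d%:~R * u 0 i)) => i.
  by have [z ->] := dP i; rewrite numq_int.
exists c.
  have [i ui] : exists i, u 0 i != 0.
    by apply/existsP; apply: contra_neqT u0 => /existsPn u0; apply/rowP => i;
      rewrite mxE; apply/eqP; rewrite -[_ == _]negbK u0.
  by exists i; rewrite -(intr_eq0 rat) -cE mulf_neq0 // intr_eq0.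
move=> j; apply/eqP; rewrite -(intr_eq0 rat) rmorph_sum /=.
have /matrixP /(_ 0 j) := uA; rewrite !mxE => uAj.
have -> : \sum_i (A i j * c i)%:~R = d%:~R * \sum_i u 0 i * AQ i j.
  rewrite mulr_sumr; apply: eq_bigr => i _.
  by rewrite mxE mulrA cE rmorphM mulrC.
by rewrite uAj mulr0.
Qed.

(** * Combinatorics of the Picard numbers of products of elliptic curves *)

Section FreeEntries.
Local Open Scope nat_scope.

(* For the product of the elliptic curves C/(Z + i y_k Z), where [y_k = 1] if
   [c k = 0] and [y_k = 2^(1/2^(c k + 1))] otherwise, an entry [(k, l)] with
   [k <= l] stands for the real part of the (k, l) entry of a Hermitian
   matrix, and one with [k > l] for the imaginary part of the (l, k) entry. The
   free entries are those that are not forced to vanish on the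
   Neron-Severi group. *)
Definition free_entry (c : nat -> nat) (i j : nat) : bool :=
  (c i == c j) && ((i <= j) || (c i == 0)).

Definition num_free_entries (g : nat) (c : nat -> nat) : nat :=
  \sum_(i < g) \sum_(j < g) free_entry c i j.

Definition attainable (g rho : nat) : Prop :=
  exists c, num_free_entries g c = rho.

Lemma sum_leq_triangle m : \sum_(i < m) \sum_(j < m) (i <= j : nat) = 'C(m.+1, 2).
Proof.
elim: m => [|m IHm]; first by rewrite big_ord0.
rewrite binS bin1 -IHm big_ord_recr /=.
have -> : \sum_(j < m.+1) (m <= j : nat) = 1.
  rewrite big_ord_recr /= leqnn big1 // => i _.
  by rewrite leqNgt ltn_ord.
under eq_bigr => i _ do rewrite big_ord_recr /= ltnW //.
by rewrite big_split /= sum1_card card_ord addn1 addnS.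
Qed.

Lemma attainable_square n : attainable n (n ^ 2).
Proof.
exists (fun=> 0); rewrite /num_free_entries.
under eq_bigr => i _ do under eq_bigr => j _ do rewrite /free_entry eqxx orbT.
by rewrite !sum_nat_const !card_ord muln1.
Qed.

(** The [m] new indices form a class of their own, of which only the upper triangle is free. *)
Lemma attainable_add g rho m :
  attainable g rho -> attainable (g + m) (rho + 'C(m.+1, 2)).
Proof.
(* [f] exceeds every [c i] with [i < g]; being nonzero, it gives a class without complex
   multiplication. *)
move=> [c <-]; pose f := (\sum_(k < g) c k).+1.
have cf i : i < g -> (c i == f) = false.
  move=> ig; apply/negbTE; rewrite neq_ltn; apply/orP; left.
  by rewrite ltnS (bigD1 (Ordinal ig)) //= leq_addr.
exists (fun i => if i < g then c i else f).
rewrite /num_free_entries big_split_ord /=; congr (_ + _).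
  apply: eq_bigr => i _; rewrite big_split_ord /= [X in _ + X]big1 ?addn0.
    by apply: eq_bigr => j _; rewrite /free_entry !ltn_ord.
  by move=> j _; rewrite /free_entry ltn_ord ltnNge leq_addr /= cf.
rewrite -sum_leq_triangle; apply: eq_bigr => i _.
rewrite big_split_ord /= big1 ?add0n => [|j _].
  apply: eq_bigr => j _.
  by rewrite /free_entry !ltnNge !leq_addr /= leq_add2l eqxx orbF.
by rewrite /free_entry ltn_ord ltnNge leq_addr /= eq_sym cf.
Qed.

Lemma attainable_add_copies g rho m r :
  attainable g rho -> attainable (g + r * m) (rho + r * 'C(m.+1, 2)).
Proof.
move=> H; elim: r => [|r IHr]; first by rewrite !mul0n !addn0.
by rewrite !mulSnr (addnA g) (addnA rho); apply: attainable_add.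
Qed.

Lemma triangular_decomposition r : exists t s, r = 'C(t, 2) + s /\ s < t.
Proof.
elim: r => [|r [t [s [-> st]]]]; first by exists 1, 0.
have [ht|ht] := leqP s.+2 t; first by exists t, s.+1; split=> //; lia.
by exists t.+1, 0; rewrite binS bin1; lia.
Qed.

Lemma pronic_decomposition r : exists n s, r = n * n.-1 + s /\ s < 2 * n.
Proof.
elim: r => [|r [n [s [-> sn]]]]; first by exists 1, 0.
have [ht|ht] := leqP (s.+2) (2 * n); first by exists n, s.+1; split; lia.
by exists n.+1, 0; split=> //=; nia.
Qed.

(** The excess of the Picard number over the dimension adds up over classes: [n * n.-1] for complex
    multiplication, ['C(t, 2)] for the class of size [t], 1 for each class of size 2, 0 for a
    singleton. *)
Lemma attainable_small g k M :
  g <= k ^ 2 -> M < (g - 6 * k) ^ 2 -> attainable g (g + M).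
Proof.
move=> gk.
have [n [r [-> ]]] := pronic_decomposition M.
have [t [s [-> st]]] := triangular_decomposition r => rn ltM.
have bE : 2 * 'C(t, 2) = t * t.-1.
  by rewrite bin2 mul2n -[RHS]odd_double_half; case: t {st rn ltM} => //= t;
   rewrite oddM /= andNb.
have ng : n <= g - 6 * k.
  rewrite leqNgt; apply/negP => h; move: ltM.
  by rewrite ltnNge; apply/negP/negPn; nia.
(* [t * t.-1] is at most twice the remainder, hence below [4 * n], and [n <= g <= k ^ 2]. *)
have tk : t <= 2 * k.
  have h1 : t * t.-1 < 4 * k ^ 2 by nia.
  by rewrite leqNgt; apply/negP => h; nia.
have pos : 0 < g - 6 * k by case: (g - 6 * k) ltM.
(* As [s < t <= 2 * k], the classes other than the first take at most [6 * k]; [pos] excludes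
   truncation in [g - 6 * k]. *)
have leg : n + t + 2 * s <= g by clear -ng tk st pos; lia.
have := attainable_add_copies 1 (g - (n + t + 2 * s))
  (attainable_add_copies 2 s (attainable_add t (attainable_square n))).
have <- : g = n + t + s * 2 + (g - (n + t + 2 * s)) * 1 by clear -leg; lia.
congr (attainable _ _).
rewrite binS bin1 (_ : 'C(3, 2) = 3) // binn.
have : n ^ 2 = n * n.-1 + n by case: n {rn ltM ng leg} => //= n; lia.
lia.
Qed.

End FreeEntries.

(** * Ranks of subgroups *)

Lemma sumz_morph (V W : zmodType) (f : V -> W) :
    {morph f : x y / x - y} ->
  forall (I : finType) (v : I -> V) (c : I -> int),
    f (\sum_i v i *~ c i) = \sum_i f (v i) *~ c i.
Proof.
move=> fB I v c.
pose fM := GRing.isZmodMorphism.Build V W f fB.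
pose F : {additive V -> W} := HB.pack f fM.
rewrite -[f]/(F : V -> W) raddf_sum; apply: eq_bigr => i _.
by rewrite raddfMz.
Qed.

Lemma has_rank_image (V W : zmodType) (f : V -> W) (S : set V) n :
  {morph f : x y / x - y} -> injective f -> has_rank S n ->
  has_rank (f @` S) n.
Proof.
move=> fB f_inj [[v Sv v_free] S_max].
have f_0 : f 0 = 0 by rewrite -[X in f X](subrr 0) fB subrr.
split.
  exists (f \o v) => [i|c]; first by exists (v i).
  rewrite -(sumz_morph fB) => f0; apply: v_free; apply: f_inj.
  by rewrite f0 f_0.
move=> m w Sw w_free.
have [i|u uP] := @choice _ _ (fun i x => S x /\ f x = w i).
  by case: (Sw i) => x Sx fx; exists x.
apply: (S_max _ u) => [i|c c0]; first by case: (uP i).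
apply: w_free; under eq_bigr => i _ do rewrite -(proj2 (uP i)).
by rewrite -(sumz_morph fB) c0.
Qed.

Lemma mxentryB (V : zmodType) m n (i : 'I_m) (j : 'I_n) :
  {morph (fun A : 'M[V]_(m, n) => A i j) : A B / A - B}.
Proof. by move=> A B; rewrite !mxE. Qed.

(** The matrix units at [P] are independent. Conversely, more than [#|P|] matrices give a
    coefficient matrix with more rows than columns, so [int_dependency] applies. *)
Lemma has_rank_support m n (P : {set 'I_m * 'I_n}) :
  has_rank [set N : 'M[int]_(m, n) | forall i j, (i, j) \notin P -> N i j = 0]
    #|P|.
Proof.
split.
  exists (fun t : 'I_#|P| => delta_mx (enum_val t).1 (enum_val t).2) => [t i j|c].
    rewrite mxE; apply: contraNeq; rewrite pnatr_eq0 eqb0 negbK.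
    move=> /andP[/eqP -> /eqP ->].
    by rewrite -surjective_pairing enum_valP.
  move=> /matrixP c0 t; have := c0 (enum_val t).1 (enum_val t).2.
  rewrite (sumz_morph (@mxentryB _ _ _ _ _)) (bigD1 t) //= big1 => [|s st].
    by rewrite !mxE !eqxx addr0 intz.
  rewrite mxE -[_ && _]/(_ == (_, _) :> _ * _) -!surjective_pairing.
  by rewrite (inj_eq enum_val_inj) eq_sym (negbTE st) mul0rz.
move=> p v Sv v_free; rewrite leqNgt; apply/negP => ltp.
pose A := \matrix_(i < p, t < #|P|) v i (enum_val t).1 (enum_val t).2.
have [|c [i ci] cA] := @int_dependency rat _ _ A.
  exact: leq_ltn_trans (rank_leq_col _) ltp.
move/eqP: ci; apply; apply: v_free i; apply/matrixP => k l.
rewrite (sumz_morph (@mxentryB _ _ _ _ _)) mxE.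
have [klP|klP] := boolP ((k, l) \in P); last first.
  by rewrite big1 // => i _; rewrite Sv // mul0rz.
rewrite -[RHS](cA (enum_rank_in klP (k, l))); apply: eq_bigr => i _.
by rewrite mxE enum_rankK_in //= mulrzz.
Qed.

(** * Hermitian forms and the upper bound on Picard numbers *)

Section HermitianForms.
Variables (R : realType) (g : nat).
Implicit Types (H : 'M[R[i]]_g) (u v : 'rV[R[i]]_g).

Lemma conj_conjc (z : R[i]) : Num.conj z = conjc z.
Proof. by []. Qed.

Lemma ImB : {morph @complex.Im R : x y / x - y}.
Proof. by case=> a b [c d]. Qed.

Lemma Im_sum (I : finType) (F : I -> R[i]) :
  complex.Im (\sum_i F i) = \sum_i complex.Im (F i).
Proof. by apply: big_morph => //; case=> a b [c d]. Qed.

Lemma Re_sum (I : finType) (F : I -> R[i]) :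
  complex.Re (\sum_i F i) = \sum_i complex.Re (F i).
Proof. by apply: big_morph => //; case=> a b [c d]. Qed.

Lemma hform_gram n (B : 'M[R[i]]_(n, g)) H (x y : 'rV_n) :
  hform H (x *m B) (y *m B) =
  \sum_b (\sum_a x 0 a * hform H (row a B) (row b B)) * (y 0 b)^*.
Proof.
pose G := B *m H *m map_mx (@Num.conj R[i]) B^T.
have GE a b : G a b = hform H (row a B) (row b B).
  rewrite /hform /form !mxE; apply: eq_bigr => l _; rewrite !mxE; congr (_ * _).
  by apply: eq_bigr => k _; rewrite !mxE.
rewrite /hform /form trmx_mul map_mxM !mulmxA -(mulmxA x B) -(mulmxA x) -/G mxE.
apply: eq_bigr => b _; rewrite !mxE; congr (_ * _).
by apply: eq_bigr => a _; rewrite GE.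
Qed.

Lemma Im_hform_gram n (B : 'M[R[i]]_(n, g)) H (x y : 'rV[R]_n) :
  complex.Im (hform H (map_mx (real_complex R) x *m B)
                      (map_mx (real_complex R) y *m B)) =
  \sum_b \sum_a x 0 a * complex.Im (hform H (row a B) (row b B)) * y 0 b.
Proof.
rewrite hform_gram Im_sum; apply: eq_bigr => b _; rewrite mulr_suml Im_sum.
apply: eq_bigr => a _; rewrite !mxE; case: (hform _ _ _) => c d.
by rewrite conj_conjc; simpc.
Qed.

Lemma hformBl u v : {morph (fun H => hform H u v) : H K / H - K}.
Proof. by move=> H K; rewrite /hform /form mulmxBr mulmxBl !mxE. Qed.

Lemma hform_delta H (a b : R[i]) k l :
  hform H (a *: delta_mx 0 k) (b *: delta_mx 0 l) = a * H k l * conjc b.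
Proof.
rewrite /hform /form -scalemxAl -rowE mxE (bigD1 l) //= big1 => [|j jl].
  by rewrite !mxE !eqxx mulr1 addr0.
by rewrite !mxE (negbTE jl) andbF mulr0 conjC0 mulr0.
Qed.

(** Multiplying the first argument by i turns imaginary parts into real parts. *)
Lemma hform_Im_eq0 H :
  (forall u v, complex.Im (hform H u v) = 0) -> H = 0.
Proof.
move=> H0; apply/matrixP => k l; rewrite mxE; apply/eqP.
rewrite eq_complex; apply/andP; split; apply/eqP => /=.
  have := H0 ('i%C *: delta_mx 0 k) (1 *: delta_mx 0 l).
  by rewrite hform_delta conjc1 mulr1 mulrC ImiRe.
have := H0 (1 *: delta_mx 0 k) (1 *: delta_mx 0 l).
by rewrite hform_delta conjc1 mulr1 mul1r.
Qed.

(** The imaginary part is biadditive, so integrality can be tested on the lattice basis. *)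
Lemma NS_gram (B : 'M[R[i]]_(g + g, g)) H :
  NS [set map_mx intr m *m B | m in [set: 'rV[int]_(g + g)]] H <->
  H \is hermsymmx /\
    forall a b, complex.Im (hform H (row a B) (row b B)) \is a Num.int.
Proof.
split=> -[Hh HB]; (split=> //);
  [move=> a b|move=> _ _ [x _ <-] [y _ <-]].
  have rowB c : row c B = map_mx intr (delta_mx 0 c : 'rV[int]__) *m B.
    by rewrite rowE; congr (_ *m _); apply/matrixP => i j;
      rewrite !mxE; case: (_ && _).
  exact: HB (ex_intro2 _ _ _ I (esym (rowB a))) (ex_intro2 _ _ _ I (esym (rowB b))).
have toR (z : 'rV[int]_(g + g)) :
    map_mx intr z = map_mx (real_complex R) (map_mx intr z).
  by apply/matrixP => i j; rewrite !mxE rmorph_int.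
rewrite !toR Im_hform_gram; apply: rpred_sum => b _; apply: rpred_sum => a _.
by rewrite !mxE !rpredM ?HB ?intr_int.
Qed.

(** Separating real and imaginary parts makes [B] a square real matrix with independent rows, hence
    invertible. *)
Lemma lattice_basis_span (B : 'M[R[i]]_(g + g, g)) :
    (forall x : 'rV[R]_(g + g), map_mx (real_complex R) x *m B = 0 -> x = 0) ->
  forall u, exists x : 'rV[R]_(g + g), u = map_mx (real_complex R) x *m B.
Proof.
move=> B_free u.
pose realify m (A : 'M[R[i]]_(m, g)) : 'M[R]_(m, g + g) :=
  row_mx (map_mx (@complex.Re R) A) (map_mx (@complex.Im R) A).
have realify_inj A A' : realify 1%N A = realify 1%N A' -> A = A'.
  move=> /eq_row_mx[/matrixP ReA /matrixP ImA]; apply/matrixP => i j.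
  have := ReA i j; have := ImA i j; rewrite !mxE.
  by case: (A i j) => a b; case: (A' i j) => c d /= -> ->.
have realifyM (x : 'rV[R]_(g + g)) :
    realify _ (map_mx (real_complex R) x *m B) = x *m realify _ B.
  rewrite mul_mx_row; congr row_mx; apply/matrixP => i j; rewrite !mxE.
    rewrite Re_sum; apply: eq_bigr => k _; rewrite !mxE; case: (B k j) => a b /=.
    by rewrite mul0r subr0.
  rewrite Im_sum; apply: eq_bigr => k _; rewrite !mxE; case: (B k j) => a b /=.
  by rewrite mul0r addr0.
have B_unit : realify _ B \in unitmx.
  rewrite -row_free_unit -kermx_eq0; apply/eqP/row_matrixP => i; rewrite row0.
  apply: B_free; apply: realify_inj; rewrite realifyM -row_mul mulmx_ker row0.
  by rewrite /realify !map_mx0 row_mx0.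
exists (realify _ u *m invmx (realify _ B)); apply: realify_inj.
by rewrite realifyM mulmxKV.
Qed.

Lemma picard_number_le (A : abelian_variety R g) rho :
  has_picard_number A rho -> (rho <= g * g)%N.
Proof.
move=> [[v NSv v_free] _]; rewrite leqNgt; apply/negP => lt_rho.
have [B B_free AE] := latticeP A.
have vP i : v i \is hermsymmx /\ forall a b,
    complex.Im (hform (v i) (row a B) (row b B)) \is a Num.int.
  by apply/NS_gram; rewrite -AE; apply: NSv.
(* A Hermitian matrix is determined by [g * g] reals: real parts on and above the diagonal,
   imaginary parts below. *)
pose K := \matrix_(i < rho) mxvec (\matrix_(k < g, l < g)
  if (k <= l)%N then complex.Re (v i k l) else complex.Im (v i k l)).
have : kermx K != 0.
  rewrite kermx_eq0 -row_leq_rank -ltnNge.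
  exact: leq_ltn_trans (rank_leq_col _) lt_rho.
case/rowV0Pn => d /sub_kermxP dK d0.
pose E := \matrix_(i < rho) mxvec (\matrix_(a < g + g, b < g + g)
  Num.floor (complex.Im (hform (v i) (row a B) (row b B)))).
have EE i a b : (E i (mxvec_index a b))%:~R =
    complex.Im (hform (v i) (row a B) (row b B)).
  by rewrite mxE mxvecE mxE floorK //; case: (vP i).
have dv : \sum_i (d 0 i)%:C%C *: v i = 0.
  have dRe (k l : 'I_g) : (k <= l)%N -> \sum_i d 0 i * complex.Re (v i k l) = 0.
    move=> kl; have /matrixP /(_ 0 (mxvec_index k l)) := dK.
    rewrite mxE [RHS]mxE => dKkl; rewrite -[RHS]dKkl.
    by apply: eq_bigr => i _; rewrite mxE mxvecE mxE kl.
  have dIm (k l : 'I_g) : (l < k)%N -> \sum_i d 0 i * complex.Im (v i k l) = 0.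
    move=> kl; have /matrixP /(_ 0 (mxvec_index k l)) := dK.
    rewrite mxE [RHS]mxE => dKkl; rewrite -[RHS]dKkl.
    by apply: eq_bigr => i _; rewrite mxE mxvecE mxE leqNgt kl.
  have herm i k l : complex.Re (v i l k) = complex.Re (v i k l) /\
      complex.Im (v i l k) = - complex.Im (v i k l).
    have [/is_hermitianmxP /matrixP /(_ l k) -> _] := vP i.
    by rewrite expr0 scale1r !mxE conj_conjc; case: (v i k l).
  apply/matrixP => k l; rewrite summxE mxE; apply/eqP; rewrite eq_complex.
  rewrite Re_sum Im_sum /=; apply/andP; split; apply/eqP.
    have [kl|/ltnW kl] := leqP k l.
      rewrite -[RHS](dRe k l kl); apply: eq_bigr => i _.
      by rewrite mxE; case: (v i k l) => a b /=; rewrite mul0r subr0.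
    rewrite -[RHS](dRe l k kl); apply: eq_bigr => i _.
    by rewrite mxE (herm i k l).1; case: (v i k l) => a b /=; rewrite mul0r subr0.
  have ImE i : complex.Im (((d 0 i)%:C%C *: v i) k l) = d 0 i * complex.Im (v i k l).
    by rewrite mxE; case: (v i k l) => a b /=; rewrite mul0r addr0.
  rewrite (eq_bigr _ (fun i _ => ImE i)).
  case: (ltngtP k l) => [kl|kl|/val_inj <-]; last 1 first.
  - rewrite big1 // => i _; have := (herm i k k).2; move/eqP.
    by rewrite -addr_eq0 -mulr2n mulrn_eq0 /= => /eqP ->; rewrite mulr0.
  - apply/eqP; rewrite -oppr_eq0 -sumrN; apply/eqP; rewrite -[RHS](dIm l k kl).
    by apply: eq_bigr => i _; rewrite (herm i k l).2 mulrN.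
  - exact: dIm.
(* The real relation [d] between the forms passes to their Gram matrices, so [E] has deficient rank
   and its rows satisfy an integral relation [c]. *)
have [|c [i ci] cE] := @int_dependency R _ _ E.
  rewrite ltnNge row_leq_rank -kermx_eq0; apply/negP => /eqP ker0.
  suff : (d <= kermx (map_mx intr E))%MS by rewrite ker0 submx0 (negbTE d0).
  apply/sub_kermxP/rowP => j; case/mxvec_indexP: j => a b; rewrite !mxE.
  under eq_bigr => i _ do rewrite [map_mx _ _ _ _]mxE EE.
  have dv0 : complex.Im (hform (\sum_i (d 0 i)%:C%C *: v i) (row a B) (row b B)) = 0.
    by rewrite dv /hform /form mulmx0 mul0mx mxE.
  rewrite -[RHS]dv0 /hform /form mulmx_sumr mulmx_suml summxE Im_sum.
  apply: eq_bigr => i _; rewrite -scalemxAr -scalemxAl [X in _ = complex.Im X]mxE.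
  by case: (_ 0 0) => x y /=; rewrite mul0r addr0.
move/eqP: ci; apply; apply: v_free i.
apply: hform_Im_eq0 => u w.
(* The relation [c] holds on the lattice basis, which spans over the reals. *)
have [x ->] := lattice_basis_span B_free u.
have [y ->] := lattice_basis_span B_free w.
rewrite Im_hform_gram big1 // => b _; rewrite big1 // => a _.
rewrite (sumz_morph (hformBl _ _)) (sumz_morph ImB).
suff -> : \sum_i complex.Im (hform (v i) (row a B) (row b B)) *~ c i = 0.
  by rewrite mulr0 mul0r.
transitivity ((\sum_i E i (mxvec_index a b) * c i)%:~R : R); last by rewrite cE.
rewrite rmorph_sum; apply: eq_bigr => i _.
by rewrite rmorphM /= EE mulrzr.
Qed.

End HermitianForms.

(** * Irrationality properties of the periods *)

Lemma sqr_neq_double_sqr (R : realType) (x y : R) :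
  x \is a Num.int -> y \is a Num.int -> y != 0 -> x ^+ 2 <> 2 * y ^+ 2.
Proof.
move=> /intrP[m ->] /intrP[n ->] n0 mn.
have : (`|m| ^ 2 = 2 * `|n| ^ 2)%N.
  rewrite -!abszX -(abszM 2); congr absz; apply: (@intr_inj R).
  by rewrite [RHS]rmorphM /= !rmorphXn /= mn.
have n_gt0 : (0 < `|n|)%N by rewrite absz_gt0 -(intr_eq0 R).
move=> /(congr1 (logn 2)); rewrite lognM ?expn_gt0 ?n_gt0 // !lognX.
rewrite (@logn_prime 2 2) //=.
lia.
Qed.

Section Periods.
Variable R : realType.

(* The square root of 2 is left out: as its square is rational, it would give
   complex multiplication. *)
Definition period (c : nat) : R :=
  if c is 0%N then 1 else iter c.+1 Num.sqrt 2.

Lemma period_gt0 c : 0 < period c.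
Proof.
by case: c => [|c] //; rewrite /period; elim: c.+2 => //= n IHn; rewrite sqrtr_gt0.
Qed.

Lemma period_pow c : (0 < c)%N -> period c ^+ (2 ^ c.+1) = 2.
Proof.
case: c => // c _; rewrite /period; elim: c.+2 => [|n IHn]; first by rewrite expr1.
have ge0 : 0 <= iter n Num.sqrt (2 : R) by case: (n) => //= k; rewrite sqrtr_ge0.
by rewrite iterS expnS exprM sqr_sqrtr.
Qed.

(** For [c > 0] the power is 2^(2^(c' - c)), a square since [c < c']. The same power of [period c']
    is 2, which tells the two periods apart. *)
Lemma period_pow_lt c c' : (c < c')%N ->
  exists2 s : nat, (0 < s)%N & period c ^+ (2 ^ c'.+1) = s%:R ^+ 2.
Proof.
case: c => [|c] cc'; first by exists 1%N => //; rewrite !expr1n.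
exists (2 ^ (2 ^ (c' - c.+2)))%N; first by rewrite expn_gt0.
rewrite (_ : c'.+1 = c.+2 + (c' - c.+2).+1)%N; last by lia.
by rewrite expnD exprM period_pow // expnSr exprM natrX.
Qed.

(** Put N = 2^(c'+1), p = a y_c and q = a y_c'. Then q^N s^2 = 2 p^N, where N is even. *)
Lemma period_ratio_lt (a : R) c c' : (c < c')%N ->
  a * period c \is a Num.int -> a * period c' \is a Num.int -> a = 0.
Proof.
move=> cc' int_c int_c'; apply/eqP/negPn/negP => a0.
have [s s0 sE] := period_pow_lt cc'.
have c'0 : (0 < c')%N by apply: leq_ltn_trans cc'.
apply: (@sqr_neq_double_sqr _ ((a * period c') ^+ (2 ^ c') * s%:R)
  ((a * period c) ^+ (2 ^ c'))).
- by rewrite rpredM ?rpredX // rpred_nat.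
- by rewrite rpredX.
- by rewrite expf_neq0 // mulf_neq0 // gt_eqF // period_gt0.
rewrite [LHS]exprMn -!exprM -expnSr !exprMn -sE period_pow //.
by rewrite -mulrA mulrCA.
Qed.

Lemma period_ratio (a : R) c c' : c != c' ->
  a * period c \is a Num.int -> a * period c' \is a Num.int -> a = 0.
Proof.
by rewrite neq_ltn => /orP[] lt ? ?; [apply: (period_ratio_lt lt)|
  apply: (period_ratio_lt lt)].
Qed.

(** With N = 2^(c'+1) and q = b y_c y_c', one has q^N = 2 b^N s^2. *)
Lemma period_prod_lt (b : R) c c' : (c < c')%N ->
  b \is a Num.int -> b * (period c * period c') \is a Num.int -> b = 0.
Proof.
move=> cc' int_b int_q; apply/eqP/negPn/negP => b0.
have [s s0 sE] := period_pow_lt cc'.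
have c'0 : (0 < c')%N by apply: leq_ltn_trans cc'.
apply: (@sqr_neq_double_sqr _ ((b * (period c * period c')) ^+ (2 ^ c'))
  (b ^+ (2 ^ c') * s%:R)).
- by rewrite rpredX.
- by rewrite rpredM ?rpredX // rpred_nat.
- by rewrite mulf_neq0 ?expf_neq0 // pnatr_eq0 -lt0n.
rewrite [in RHS]exprMn -!exprM -expnSr !exprMn -sE period_pow //.
by rewrite mulrA mulrC.
Qed.

Lemma period_prod (b : R) c c' : (c != 0) || (c' != 0) ->
  b \is a Num.int -> b * (period c * period c') \is a Num.int -> b = 0.
Proof.
have [lt _|lt _|<-] := ltngtP c c'.
- exact: period_prod_lt lt.
- by rewrite [period c * _]mulrC; apply: period_prod_lt lt.
rewrite orbb -lt0n => c0 int_b int_q; apply/eqP/negPn/negP => b0.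
(* For equal indices the exponent 2^c suffices: it takes the squared period to 2, and is even as
   [c > 0]. *)
have e2 : (2 ^ c = 2 ^ c.-1 * 2)%N by rewrite -expnSr prednK.
apply: (@sqr_neq_double_sqr _ ((b * (period c * period c)) ^+ (2 ^ c.-1))
  (b ^+ (2 ^ c.-1))); rewrite ?rpredX ?expf_neq0 //.
rewrite -!exprM -e2 exprMn -expr2 -exprM -expnS period_pow //.
by rewrite mulrC.
Qed.

End Periods.

(** * Neron-Severi groups of products of elliptic curves *)

Section SquareTorus.
Variables (R : realType) (g : nat).
Implicit Types (H : 'M[R[i]]_g).

(* The basis e_k, i y_k e_k of the lattice of the product of the elliptic
   curves C/(Z + i y_k Z). *)
Definition diag_basis (y : 'I_g -> R) : 'M[R[i]]_(g + g, g) :=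
  col_mx 1%:M (diag_mx (\row_k (0 +i* y k)%C)).

Definition diag_lattice (y : 'I_g -> R) : set 'rV[R[i]]_g :=
  [set map_mx intr m *m diag_basis y | m in [set: 'rV[int]_(g + g)]].

Lemma row_diag_basis_l y k :
  row (lshift g k) (diag_basis y) = 1 *: delta_mx 0 k.
Proof. by rewrite rowKu row1 scale1r. Qed.

Lemma row_diag_basis_r y k :
  row (rshift g k) (diag_basis y) = (0 +i* y k)%C *: delta_mx 0 k.
Proof.
rewrite rowKd; apply/rowP => l; rewrite !mxE eqxx /= eq_sym.
by case: eqP => _; rewrite ?mulr1n ?mulr1 ?mulr0n ?mulr0.
Qed.

Lemma diag_latticeP y : (forall k, 0 < y k) -> is_lattice (diag_lattice y).
Proof.
move=> y0; exists (diag_basis y) => // x x0.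
have xE k : x 0 (lshift g k) = 0 /\ x 0 (rshift g k) * y k = 0.
  have /rowP /(_ k) := x0; rewrite -{1}[x]hsubmxK map_row_mx mul_row_col mulmx1.
  rewrite mul_mx_diag !mxE /= => /eqP; rewrite eq_complex /= => /andP[/eqP + /eqP].
  by rewrite !(mul0r, mulr0, subr0, addr0, add0r).
apply/rowP => j; rewrite [RHS]mxE -(fintype.splitK j).
case: (fintype.split j) => k /=.
  by case: (xE k).
by case: (xE k) => _ /eqP; rewrite mulf_eq0 (gt_eqF (y0 k)) orbF => /eqP.
Qed.

(** Up to sign, the four numbers are the imaginary parts of the form on e_k or i y_k e_k against e_l
    or i y_l e_l. *)
Lemma NS_diag_lattice y H : NS (diag_lattice y) H <->
  H \is hermsymmx /\ forall k l,
    [/\ complex.Im (H k l) \is a Num.int,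
        complex.Re (H k l) * y k \is a Num.int,
        complex.Re (H k l) * y l \is a Num.int &
        complex.Im (H k l) * (y k * y l) \is a Num.int].
Proof.
have bE k l (a b : R[i]) := hform_delta H a b k l.
split=> [/NS_gram [Hh HB]|[Hh HB]].
  split=> // k l; split.
  - have := HB (lshift g k) (lshift g l).
    by rewrite !row_diag_basis_l bE conjc1 mul1r mulr1.
  - have := HB (rshift g k) (lshift g l).
    rewrite row_diag_basis_l row_diag_basis_r bE conjc1 mulr1.
    by case: (H k l) => a b /=; rewrite mul0r add0r mulrC.
  - have := HB (lshift g k) (rshift g l).
    rewrite row_diag_basis_l row_diag_basis_r bE mul1r.
    by case: (H k l) => a b /=; rewrite mulr0 addr0 mulrN rpredN.
  have := HB (rshift g k) (rshift g l).
  rewrite !row_diag_basis_r bE; case: (H k l) => a b /=.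
  rewrite !(mul0r, mulr0, oppr0, addr0, add0r, sub0r) mulrN mulNr opprK.
  by rewrite mulrAC mulrC.
apply/NS_gram; split=> // a b.
rewrite -(fintype.splitK a) -(fintype.splitK b).
case: (fintype.split a) (fintype.split b) => k [] l /=;
  rewrite ?row_diag_basis_l ?row_diag_basis_r bE;
  have [] := HB k l; case: (H k l) => p q /=;
  rewrite ?(mul0r, mulr0, oppr0, addr0, add0r, sub0r, mul1r, subr0, mulr1)//.
- by rewrite mulrN rpredN.
- by rewrite mulrC.
- by rewrite mulrNN [y k * q]mulrC -mulrA.
Qed.

Lemma diag_lattice_polarizable y : (forall k, 0 < y k) ->
  exists2 H, NS (diag_lattice y) H & posdef H.
Proof.
(* The product of the principal polarizations of the factors. *)
move=> y0; exists (diag_mx (\row_k ((y k)^-1)%:C%C)).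
  apply/NS_diag_lattice; split=> [|k l].
    apply/is_hermitianmxP/matrixP => k l; rewrite expr0 scale1r !mxE eq_sym.
    case: eqP => [->|_]; last by rewrite !mulr0n rmorph0.
    by rewrite !mulr1n conj_conjc conjc_real.
  rewrite !mxE; case: eqP => [->|_]; last by rewrite /= !mul0r; split; apply: rpred0.
  by rewrite /= !mul0r mulVf ?gt_eqF //; split; rewrite ?rpred0 ?rpred1.
move=> v v0; rewrite /hform /form mxE.
have vE l : (v *m diag_mx (\row_k ((y k)^-1)%:C%C)) 0 l *
    map_mx (@Num.conj R[i]) v^T l 0 = `|v 0 l| ^+ 2 * ((y l)^-1)%:C%C.
  by rewrite mul_mx_diag !mxE mulrAC sqr_normc.
have vge0 l : 0 <= `|v 0 l| ^+ 2 * ((y l)^-1)%:C%C :> R[i].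
  by rewrite mulr_ge0 ?exprn_ge0 // ler0c invr_ge0 ltW.
rewrite (eq_bigr _ (fun l _ => vE l)) lt_neqAle sumr_ge0 ?andbT //.
apply: contra v0 => /eqP/esym/(psumr_eq0P (fun l _ => vge0 l)) v0.
apply/eqP/rowP => l; have /eqP := v0 l isT.
rewrite mulf_eq0 expf_eq0 /= normr_eq0 orbC mxE => /orP[|/eqP //].
by rewrite eq_complex /= invr_eq0 gt_eqF.
Qed.

Definition diag_variety y (y0 : forall k, 0 < y k) : abelian_variety R g :=
  AbelianVariety (diag_latticeP y0) (diag_lattice_polarizable y0).

(* For [k <= l], the entry [N k l] encodes the real part of [H k l] and, for
   [l < k], the entry [N k l] encodes the imaginary part of [H l k]. *)
Definition decode (y : 'I_g -> R) (N : 'M[int]_g) : 'M[R[i]]_g :=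
  \matrix_(k, l)
    (((if (k <= l)%N then N k l else N l k)%:~R / y k) +i*
     (if (k < l)%N then N l k else if (l < k)%N then - N k l else 0)%:~R)%C.

Lemma decodeB y : {morph decode y : N N' / N - N'}.
Proof.
move=> N N'; apply/matrixP => k l; rewrite !mxE /=.
apply/eqP; rewrite eq_complex /=; apply/andP; split; apply/eqP.
  by rewrite -mulrBl -rmorphB /=; congr (_%:~R / _); case: leqP.
rewrite -rmorphB /=; congr (_%:~R).
by case: ltngtP => //; rewrite ?opprB ?subrr // opprK addrC.
Qed.

Lemma decode_inj y : (forall k, 0 < y k) -> injective (decode y).
Proof.
move=> y0 N N' /matrixP NN'; apply/matrixP => k l.
have := NN' k l; rewrite !mxE => -[].
case: ltngtP => [kl|lk|/val_inj <-] /=.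
- by move=> /(mulIf _)/intr_inj -> //; rewrite invr_eq0 gt_eqF.
- by move=> _ /intr_inj /oppr_inj.
- by move=> /(mulIf _)/intr_inj -> //; rewrite invr_eq0 gt_eqF.
Qed.

(** [period_ratio] kills real parts between distinct classes, and [period_prod] kills imaginary
    parts outside the class of period 1. On the surviving entries the conditions reduce to
    integrality. *)
Lemma NS_decode (c : nat -> nat) (y := fun k : 'I_g => period R (c k)) :
  NS (diag_lattice y) =
  decode y @` [set N : 'M[int]_g | forall k l : 'I_g,
    (k, l) \notin [set p : 'I_g * 'I_g | free_entry c p.1 p.2]%SET ->
    N k l = 0].
Proof.
have y0 k : 0 < y k by apply: period_gt0.
have yn0 k : y k != 0 by rewrite gt_eqF.
apply/seteqP; split=> [H /NS_diag_lattice [/is_hermitianmxP Hh HB]|_ [N NP <-]].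
  have herm k l : H k l = conjc (H l k).
    by rewrite {1}Hh expr0 scale1r !mxE.
  have Re0 (k l : 'I_g) : c k != c l -> complex.Re (H k l) = 0.
    by move=> ckl; have [_ ? ? _] := HB k l; apply: (period_ratio ckl).
  have Im0 (k l : 'I_g) : (c k != 0) || (c l != 0) -> complex.Im (H k l) = 0.
    by move=> ckl; have [? _ _ ?] := HB k l; apply: (period_prod ckl).
  (* The sign below the diagonal comes from Im H_lk = - Im H_kl. *)
  exists (\matrix_(k, l) if (k <= l)%N then Num.floor (complex.Re (H k l) * y k)
                         else - Num.floor (complex.Im (H k l))).
    move=> k l; rewrite inE /free_entry /= mxE negb_and negb_or => h.
    case: leqP h => [kl|lk]; rewrite /= ?orbF ?andbF ?orbF => h.
      by rewrite Re0 // mul0r floor0.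
    rewrite Im0 ?floor0 ?oppr0 //.
    by case/orP: h => [|-> //]; case: (c k) (c l) => [|?] [|?].
  apply/matrixP => k l; rewrite !mxE; apply/eqP; rewrite eq_complex /=.
  apply/andP; split; apply/eqP.
    case: (leqP k l) => kl.
      by rewrite floorK ?mulfK //; case: (HB k l).
    rewrite (ltnW kl) floorK; last by case: (HB l k).
    rewrite (herm k l); have [ckl|ckl] := eqVneq (c l) (c k).
      have -> : y l = y k by rewrite /y ckl.
      by rewrite mulfK //; case: (H l k).
    by rewrite Re0 // !mul0r; move: (Re0 _ _ ckl); case: (H l k) => a b /= ->.
  case: ltngtP => [kl|lk|/val_inj <-] /=.
  - rewrite (herm k l) rmorphN /= floorK; last by case: (HB l k).
    by case: (H l k).
  - by rewrite opprK floorK; case: (HB k l).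
  - have := congr1 (@complex.Im R) (herm k k); case: (H k k) => a b /= /eqP.
    by rewrite -addr_eq0 -mulr2n mulrn_eq0 /= => /eqP ->.
apply/NS_diag_lattice.
have NP' k l : N k l = 0 \/ y k = y l /\ ((l < k)%N -> y k = 1).
  have [|/NP] := boolP ((k, l) \in [set p : 'I_g * 'I_g | free_entry c p.1 p.2]%SET);
    last by left.
  rewrite inE /free_entry /= => /andP[/eqP ckl h]; right; rewrite /y ckl; split=> //.
  by rewrite ltnNge => /negbTE kl; move: h; rewrite kl ckl /= => /eqP ->.
split=> [|k l].
  apply/is_hermitianmxP/matrixP => k l; rewrite expr0 scale1r !mxE conj_conjc /=.
  apply/eqP; rewrite eq_complex /=; apply/andP; split; apply/eqP.
    case: ltngtP => [kl|kl|/val_inj -> //].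
      by case: (NP' k l) => [->|[-> _]]; rewrite ?mul0r.
    by case: (NP' l k) => [->|[-> _]]; rewrite ?mul0r.
  by rewrite -rmorphN; congr (_%:~R); case: ltngtP; rewrite ?oppr0 ?opprK.
rewrite mxE /=; split; first exact: intr_int.
- by rewrite divfK // intr_int.
- case: leqP => _.
    case: (NP' k l) => [->|[yE _]]; first by rewrite !mul0r rpred0.
    by rewrite -yE divfK // intr_int.
  case: (NP' l k) => [->|[yE _]]; first by rewrite !mul0r rpred0.
  by rewrite yE divfK // intr_int.
case: ltngtP => kl; last by rewrite mul0r rpred0.
  case: (NP' l k) => [->|[yE y1]]; first by rewrite mul0r rpred0.
  by rewrite -yE y1 // !mulr1 intr_int.
case: (NP' k l) => [->|[yE y1]]; first by rewrite oppr0 mul0r rpred0.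
by rewrite -yE y1 // !mulr1 intr_int.
Qed.

Lemma picard_numbers_attainable rho : attainable g rho -> picard_numbers R g rho.
Proof.
move=> [c <-]; exists (diag_variety (fun k : 'I_g => period_gt0 R (c k))).
rewrite /has_picard_number /= NS_decode.
have -> : num_free_entries g c =
    #|[set p : 'I_g * 'I_g | free_entry c p.1 p.2]%SET|.
  rewrite /num_free_entries pair_bigA /= -sum1_card [RHS]big_mkcond /=.
  by apply: eq_bigr => p _; rewrite inE; case: free_entry.
apply: has_rank_image; [exact: decodeB| |exact: has_rank_support].
by apply: decode_inj => k; apply: period_gt0.
Qed.

End SquareTorus.

(** * Cardinality estimates and the limit *)

Lemma sub_picard_numbers (R : realType) g :
  picard_numbers R g `<=` `I_(g * g).+1.
Proof. by move=> rho [A /picard_number_le]. Qed.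

Lemma num_picard_numbers_le (R : realType) g :
  (num_picard_numbers R g <= (g * g).+1)%N.
Proof. by apply/geq_card_fset_set/subset_card_le/sub_picard_numbers. Qed.

(** Subtracting [g] maps the Picard numbers onto a set containing every [M < (g - 6 * k) ^ 2]. *)
Lemma num_picard_numbers_ge (R : realType) g k : (g <= k ^ 2)%N ->
  ((g - 6 * k) ^ 2 <= num_picard_numbers R g)%N.
Proof.
move=> gk; apply: leq_card_fset_set.
  exact: sub_finite_set (@sub_picard_numbers R g) (finite_II _).
apply: card_le_trans (card_image_le (subn^~ g) _); apply: subset_card_le => M ltM.
exists (g + M)%N; last by rewrite addKn.
exact/picard_numbers_attainable/(attainable_small gk).
Qed.

(** This is the error bound 12 / K with denominators cleared. For k = floor(g / K), the assumption
    on [g] gives g <= k^2, and passing from g^2 to (g - 6k)^2 loses at most 12kg <= 12g^2 / K. *)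
Lemma num_picard_numbers_bounds (R : realType) K g : (0 < K)%N ->
    (2 * K * K <= g)%N ->
  (K * g ^ 2 <= K * num_picard_numbers R g + 12 * g ^ 2)%N /\
  (K * num_picard_numbers R g <= K * g ^ 2 + 12 * g ^ 2)%N.
Proof.
move=> K0 Kg; pose k := (g %/ K)%N.
have kK : (k * K <= g)%N by apply: leq_divM.
have gk : (g < k.+1 * K)%N by apply: ltn_ceil.
have K2k : (2 * K <= k)%N by rewrite leq_divRL.
have ub := num_picard_numbers_le R g.
have lb : ((g - 6 * k) ^ 2 <= num_picard_numbers R g)%N.
  apply/num_picard_numbers_ge/ltnW/(leq_trans gk).
  by move: K2k K0; clear; nia.
have sq : (g ^ 2 <= (g - 6 * k) ^ 2 + 12 * (k * g))%N.
  clear; have [|/ltnW /subnKC <-] := leqP g (6 * k); first by nia.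
  by rewrite addKn; nia.
have kKg : (K * (k * g) <= g ^ 2)%N.
  by rewrite mulnA [(K * k)%N]mulnC leq_mul2r kK orbT.
split.
  have : (K * g ^ 2 <= K * (num_picard_numbers R g + 12 * (k * g)))%N.
    by rewrite leq_mul2l (leq_trans sq) ?orbT // leq_add2r.
  by rewrite mulnDr mulnCA; move: kKg; clear; lia.
have : (K * num_picard_numbers R g <= K * (g * g).+1)%N by rewrite leq_mul2l ub orbT.
have : (K <= g ^ 2)%N by move: Kg K0; clear; nia.
by clear; lia.
Qed.

Theorem theorem1p2 (R : realType) :
  (fun g : nat => (num_picard_numbers R g)%:R / g%:R ^+ 2 : R) @ \oo --> (1 : R).
Proof.
(* [K] is chosen so that the error bound 12 / K is at most [e]. *)
apply/cvgrPdist_le => e e0; pose K := (Num.truncn (12 / e)).+1.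
have Ke : 12 / K%:R <= e.
  by rewrite ler_pdivrMr // mulrC -ler_pdivrMr // ltW // truncnS_gt.
near=> g.
have Kg : (2 * K * K <= g)%N by near: g; exists (2 * K * K)%N.
have g0 : (0 < g)%N by apply: leq_trans Kg; rewrite !muln_gt0.
have [lb ub] := num_picard_numbers_bounds R (ltn0Sn _) Kg.
apply: le_trans Ke; set p := num_picard_numbers R g in lb ub *.
have {}lb : K%:R * g%:R ^+ 2 <= K%:R * p%:R + 12 * g%:R ^+ 2 :> R.
  by rewrite -!natrX -!natrM -natrD ler_nat.
have {}ub : K%:R * p%:R <= K%:R * g%:R ^+ 2 + 12 * g%:R ^+ 2 :> R.
  by rewrite -!natrX -!natrM -natrD ler_nat.
have g2 : 0 < g%:R ^+ 2 :> R by rewrite exprn_gt0 // ltr0n.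
have K0 : 0 < K%:R :> R by rewrite ltr0n.
have -> : 1 - p%:R / g%:R ^+ 2 = (g%:R ^+ 2 - p%:R) / g%:R ^+ 2 :> R.
  by rewrite mulrBl divff // gt_eqF.
rewrite normrM [X in _ * X]gtr0_norm ?invr_gt0 // ler_pdivrMr //.
rewrite mulrAC ler_pdivlMr // mulrC -[X in X * _]gtr0_norm // -normrM.
by rewrite ler_norml; apply/andP; split; lra.
Unshelve. all: by end_near.
Qed.
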